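(* Let $(\mathcal{P},\Pi,\mathrel{h})$ be a point–plane incidence structure satisfying Axioms [1]–[4] described in the context. Then Axiom [P] holds if and only if its spatial dual, Axiom [P$^*$], holds. Axiom [P]: let $\ell_1\neq\ell_2$ be lines with a common point $O$ and a common plane $\omega$; let $A_1,B_1,C_1\in(\ell_1)_{\mathcal{P}}$ and $A_2,B_2,C_2\in(\ell_2)_{\mathcal{P}}$ be six points, pairwise distinct and all distinct from $O$. Then the three points $A_0=(B_1C_2)\cdot(B_2C_1)$, $B_0=(C_1A_2)\cdot(C_2A_1)$, $C_0=(A_1B_2)\cdot(A_2B_1)$ are collinear. Axiom [P$^*$]: let $\ell_1\neq\ell_2$ be lines with a common point $O$ and a common plane $\omega$; let $\alpha_1,\beta_1,\gamma_1\in(\ell_1)_{\Pi}$ and $\alpha_2,\beta_2,\gamma_2\in(\ell_2)_{\Pi}$ be six planes, pairwise distinct and all distinct from $\omega$. Then the three planes $\alpha_0=(\beta_1\gamma_2)\,\square\,(\beta_2\gamma_1)$, $\beta_0=(\gamma_1\alpha_2)\,\square\,(\gamma_2\alpha_1)$, $\gamma_0=(\alpha_1\beta_2)\,\square\,(\alpha_2\beta_1)$ are collinear.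
   Context: $\mathcal{P}$ (points) and $\Pi$ (planes) are disjoint nonempty sets with an incidence relation $\mathrel{h}\subseteq \mathcal{P}\times\Pi$ (written symmetrically). For $\mathbf{S}\subseteq\mathcal{P}$, $\mathbf{S}^{h}\subseteq\Pi$ is the set of planes incident with every point of $\mathbf{S}$; for $\mathbf{\Sigma}\subseteq\Pi$, $\mathbf{\Sigma}^{h}\subseteq\mathcal{P}$ is the set of points incident with every plane of $\mathbf{\Sigma}$; $X^{hh}=(X^h)^h$. $\mathbf{S}\mathrel{h}\mathbf{\Sigma}$ means $P\mathrel{h}\pi$ for all $P\in\mathbf{S},\pi\in\mathbf{\Sigma}$. The axioms are: [1] For every $P\in\mathcal{P}$, $P^h\neq\Pi$; for every $\pi\in\Pi$, $\pi^h\neq\mathcal{P}$. [2] For all $A,B\in\mathcal{P}$, $|\{A,B\}^h|>2$; for all $\alpha,\beta\in\Pi$, $|\{\alpha,\beta\}^h|>2$. [3] For all $A,B,C\in\mathcal{P}$, $\{A,B,C\}^h\neq\emptyset$; for all $\alpha,\beta,\gamma\in\Pi$, $\{\alpha,\beta,\gamma\}^h\neq\emptyset$. [4] If $A\neq B$ in $\mathcal{P}$, $\alpha\neq\beta$ in $\Pi$ and $\{A,B\}\mathrel{h}\{\alpha,\beta\}$, then $\{A,B\}^h=\{\alpha,\beta\}^{hh}$ and $\{\alpha,\beta\}^h=\{A,B\}^{hh}$. A line is a subset $\ell=\ell_{\mathcal{P}}\cup\ell_{\Pi}$ of $\mathcal{P}\cup\Pi$ with $\ell_{\mathcal{P}}=\{A,B\}^{hh}=\{\alpha,\beta\}^h$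 and $\ell_{\Pi}=\{\alpha,\beta\}^{hh}=\{A,B\}^h$ for some $A\neq B$ in $\mathcal{P}$ and $\alpha\neq\beta$ in $\Pi$ with $\{A,B\}\mathrel{h}\{\alpha,\beta\}$. For distinct points $A,B$, $AB$ denotes the line with $(AB)_{\mathcal{P}}=\{A,B\}^{hh}$, $(AB)_{\Pi}=\{A,B\}^h$; for distinct planes $\alpha,\beta$, $\alpha\beta$ denotes the line with $(\alpha\beta)_{\mathcal{P}}=\{\alpha,\beta\}^h$, $(\alpha\beta)_\Pi=\{\alpha,\beta\}^{hh}$. Points (resp. planes) are collinear if they all lie in $\ell_{\mathcal{P}}$ (resp. $\ell_{\Pi}$) for a single line $\ell$. For distinct lines $m,n$: $m_{\mathcal{P}}\cap n_{\mathcal{P}}\neq\emptyset$ iff $m_\Pi\cap n_\Pi\neq\emptyset$, and in that case both intersections are singletons, written $m_{\mathcal{P}}\cap n_{\mathcal{P}}=\{m\cdot n\}$ and $m_{\Pi}\cap n_{\Pi}=\{m\,\square\, n\}$; in the configurations of the claim the relevant pairs of lines are distinct and meet, so $A_0,B_0,C_0,\alpha_0,\beta_0,\gamma_0$ are well defined. *)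

(* Defs.v *)
From mathcomp Require Import all_boot.
From mathcomp Require Import boolp classical_sets functions cardinality.
From Stdlib Require List.

Set Implicit Arguments.
Unset Strict Implicit.
Unset Printing Implicit Defensive.

Local Open Scope classical_set_scope.
Local Open Scope card_scope.

(* S^h for a set S of points, and Sigma^h for a set Sigma of planes. *)
Definition hplanes (P Pi : Type) (h : P -> Pi -> Prop) (S : set P) : set Pi :=
  [set pi | forall X, S X -> h X pi].

Definition hpoints (P Pi : Type) (h : P -> Pi -> Prop) (Sigma : set Pi) :
    set P :=
  [set X | forall pi, Sigma pi -> h X pi].

Definition hpoints2 (P Pi : Type) (h : P -> Pi -> Prop) (S : set P) : set P :=
  hpoints h (hplanes h S).

Definition hplanes2 (P Pi : Type) (h : P -> Pi -> Prop) (Sigma : set Pi) :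
    set Pi :=
  hplanes h (hpoints h Sigma).

Definition hsets (P Pi : Type) (h : P -> Pi -> Prop) (S : set P)
    (Sigma : set Pi) : Prop :=
  forall X pi, S X -> Sigma pi -> h X pi.

Definition axiom1 (P Pi : Type) (h : P -> Pi -> Prop) : Prop :=
  (forall A : P, hplanes h [set A] <> setT) /\
  (forall alpha : Pi, hpoints h [set alpha] <> setT).

(* `I_3 #<= X says that X has more than two elements. *)
Definition axiom2 (P Pi : Type) (h : P -> Pi -> Prop) : Prop :=
  (forall A B : P, `I_3 #<= hplanes h [set A; B]) /\
  (forall alpha beta : Pi, `I_3 #<= hpoints h [set alpha; beta]).

Definition axiom3 (P Pi : Type) (h : P -> Pi -> Prop) : Prop :=
  (forall A B C : P, hplanes h [set A; B; C] <> set0) /\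
  (forall alpha beta gamma : Pi, hpoints h [set alpha; beta; gamma] <> set0).

Definition axiom4 (P Pi : Type) (h : P -> Pi -> Prop) : Prop :=
  forall (A B : P) (alpha beta : Pi),
    A <> B -> alpha <> beta -> hsets h [set A; B] [set alpha; beta] ->
    hplanes h [set A; B] = hplanes2 h [set alpha; beta] /\
    hpoints h [set alpha; beta] = hpoints2 h [set A; B].

(* The union of the disjoint sets of points and planes is the sum type
   P + Pi; l_P and l_Pi are the traces of l on the two summands. *)
Definition pts (P Pi : Type) (l : set (P + Pi)) : set P := inl @^-1` l.

Definition pls (P Pi : Type) (l : set (P + Pi)) : set Pi := inr @^-1` l.

Definition is_line (P Pi : Type) (h : P -> Pi -> Prop) (l : set (P + Pi)) :
    Prop :=
  exists (A B : P) (alpha beta : Pi),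
    [/\ A <> B, alpha <> beta & hsets h [set A; B] [set alpha; beta]] /\
    [/\ pts l = hpoints2 h [set A; B], pts l = hpoints h [set alpha; beta],
        pls l = hplanes2 h [set alpha; beta] & pls l = hplanes h [set A; B]].

(* The lines AB and alpha beta; meaningful for A <> B, resp. alpha <> beta. *)
Definition join_line (P Pi : Type) (h : P -> Pi -> Prop) (A B : P) :
    set (P + Pi) :=
  inl @` hpoints2 h [set A; B] `|` inr @` hplanes h [set A; B].

Definition meet_line (P Pi : Type) (h : P -> Pi -> Prop) (alpha beta : Pi) :
    set (P + Pi) :=
  inl @` hpoints h [set alpha; beta] `|` inr @` hplanes2 h [set alpha; beta].

(* X is the point m \cdot n, resp. pi is the plane m \square n. *)
Definition is_dot (P Pi : Type) (m n : set (P + Pi)) (X : P) : Prop :=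
  pts m `&` pts n = [set X].

Definition is_square (P Pi : Type) (m n : set (P + Pi)) (pi : Pi) : Prop :=
  pls m `&` pls n = [set pi].

Definition collinear_points (P Pi : Type) (h : P -> Pi -> Prop) (S : set P) :
    Prop :=
  exists2 l, is_line h l & S `<=` pts l.

Definition collinear_planes (P Pi : Type) (h : P -> Pi -> Prop)
    (Sigma : set Pi) : Prop :=
  exists2 l, is_line h l & Sigma `<=` pls l.

Definition axiomP (P Pi : Type) (h : P -> Pi -> Prop) : Prop :=
  forall (l1 l2 : set (P + Pi)) (O : P) (omega : Pi)
         (A1 B1 C1 A2 B2 C2 A0 B0 C0 : P),
    is_line h l1 -> is_line h l2 -> l1 <> l2 ->
    pts l1 O -> pts l2 O -> pls l1 omega -> pls l2 omega ->
    [/\ pts l1 A1, pts l1 B1 & pts l1 C1] ->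
    [/\ pts l2 A2, pts l2 B2 & pts l2 C2] ->
    List.NoDup [:: O; A1; B1; C1; A2; B2; C2] ->
    is_dot (join_line h B1 C2) (join_line h B2 C1) A0 ->
    is_dot (join_line h C1 A2) (join_line h C2 A1) B0 ->
    is_dot (join_line h A1 B2) (join_line h A2 B1) C0 ->
    collinear_points h [set A0; B0; C0].

Definition axiomPstar (P Pi : Type) (h : P -> Pi -> Prop) : Prop :=
  forall (l1 l2 : set (P + Pi)) (O : P) (omega : Pi)
         (alpha1 beta1 gamma1 alpha2 beta2 gamma2 alpha0 beta0 gamma0 : Pi),
    is_line h l1 -> is_line h l2 -> l1 <> l2 ->
    pts l1 O -> pts l2 O -> pls l1 omega -> pls l2 omega ->
    [/\ pls l1 alpha1, pls l1 beta1 & pls l1 gamma1] ->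
    [/\ pls l2 alpha2, pls l2 beta2 & pls l2 gamma2] ->
    List.NoDup [:: omega; alpha1; beta1; gamma1; alpha2; beta2; gamma2] ->
    is_square (meet_line h beta1 gamma2) (meet_line h beta2 gamma1) alpha0 ->
    is_square (meet_line h gamma1 alpha2) (meet_line h gamma2 alpha1) beta0 ->
    is_square (meet_line h alpha1 beta2) (meet_line h alpha2 beta1) gamma0 ->
    collinear_planes h [set alpha0; beta0; gamma0].

(* Main.v *)
Require Import Defs.
From mathcomp Require Import all_boot.
From mathcomp Require Import boolp classical_sets functions cardinality.

Local Open Scope classical_set_scope.

Set Implicit Arguments.
Unset Strict Implicit.

(** All planes of a configuration of [P*] pass through [O]; cutting with a plane
    [sigma] not through [O] turns it into a plane configuration of two pencils
    of three lines [a1, b1, c1] and [a2, b2, c2].  Axiom [P] applies to the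
    points [b1 a2, b1 c2, L1] of [b1] and [c1 b2, a1 b2, L2] of [b2], where
    [L1], [L2] are the centres of the pencils.  Its three diagonal points are
    [c2 a1], [c1 a2], which span the trace of [beta0], and the common point [X]
    of the traces of [alpha0] and [gamma0].  So [alpha0, beta0, gamma0] all
    contain the line [O X].  The converse is the same argument for the structure
    with points and planes exchanged. *)

(** * Exchange of points and planes *)

Section Duality.

Variables (P Pi : Type) (h : P -> Pi -> Prop).

Local Notation dual := (fun (pi : Pi) (X : P) => h X pi).

Lemma axiom1_dual : axiom1 h -> axiom1 dual.
Proof. by case. Qed.

Lemma axiom2_dual : axiom2 h -> axiom2 dual.
Proof. by case. Qed.

Lemma axiom3_dual : axiom3 h -> axiom3 dual.
Proof. by case. Qed.

Lemma axiom4_dual : axiom4 h -> axiom4 dual.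
Proof.
move=> ax4 al be A B nal nA hs.
have [|e1 e2] := ax4 A B al be nA nal; last by split.
by move=> X pi SX Spi; apply: hs.
Qed.

(** Lines of the dual structure live in [Pi + P]. By computation, the points of [swap_line l] are
    the planes in [pts l]'s counterpart [pls l], and its planes are [pts l]. *)
Definition swap_line (l : set (Pi + P)) : set (P + Pi) :=
  [set x | l match x with inl X => inr X | inr pi => inl pi end].

Lemma is_line_swap (l : set (Pi + P)) :
  is_line dual l -> is_line h (swap_line l).
Proof.
move=> [al [be [A [B [[nal nA hs] [e1 e2 e3 e4]]]]]].
exists A, B, al, be; split; split => //.
by move=> X pi SX Spi; apply: hs.
Qed.

Lemma swap_line_inj (l m : set (Pi + P)) :
  swap_line l = swap_line m -> l = m.
Proof.
move=> e; apply/funext => -[pi|X].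
- exact: (f_equal (fun s : set (P + Pi) => s (inr pi)) e).
- exact: (f_equal (fun s : set (P + Pi) => s (inl X)) e).
Qed.

Lemma pts_join (A B : P) : pts (join_line h A B) = hpoints2 h [set A; B].
Proof.
by apply/seteqP; split=> X /=; [case=> -[Y HY] // [<-] | move=> HX; left; exists X].
Qed.

Lemma pts_meet (al be : Pi) : pts (meet_line h al be) = hpoints h [set al; be].
Proof.
by apply/seteqP; split=> X /=; [case=> -[Y HY] // [<-] | move=> HX; left; exists X].
Qed.

Lemma pls_meet (al be : Pi) : pls (meet_line h al be) = hplanes2 h [set al; be].
Proof.
by apply/seteqP; split=> X /=; [case=> -[Y HY] // [<-] | move=> HX; right; exists X].
Qed.

End Duality.

(** A join in the dual structure is a meet in [h], so after [swap_line] the hypotheses of one axiom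
    become those of the other, with [O] and [om] exchanged. *)
Lemma axiomP_dual (P Pi : Type) (h : P -> Pi -> Prop) :
  axiomPstar h -> axiomP (fun pi X => h X pi).
Proof.
move=> ps l1 l2 O om a1 b1 c1 a2 b2 c2 a0 b0 c0 L1 L2 nl h1 h2 h3 h4 H1 H2 nd.
rewrite /is_dot !pts_join => d1 d2 d3.
have [|||l ll sl] := ps (swap_line l1) (swap_line l2) om O a1 b1 c1 a2 b2 c2
  a0 b0 c0 (is_line_swap L1) (is_line_swap L2)
  (fun e => nl (swap_line_inj e)) h3 h4 h1 h2 H1 H2 nd.
- by rewrite /is_square !pls_meet.
- by rewrite /is_square !pls_meet.
- by rewrite /is_square !pls_meet.
exists (swap_line l) => //.
exact: (@is_line_swap _ _ (fun pi X => h X pi)).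
Qed.

(** * Incidence of points with planes and with their axes *)

Section Geometry.

Variables (P Pi : Type) (h : P -> Pi -> Prop).
Hypotheses (ax1 : axiom1 h) (ax2 : axiom2 h) (ax3 : axiom3 h) (ax4 : axiom4 h).

Lemma hpoints_setU2 (al be : Pi) (X : P) :
  hpoints h [set al; be] X <-> h X al /\ h X be.
Proof.
split=> [H|[Ha Hb] pi [->|->]] //.
by split; apply: H; [left|right].
Qed.

Lemma hplanes_setU2 (A B : P) (pi : Pi) :
  hplanes h [set A; B] pi <-> h A pi /\ h B pi.
Proof.
split=> [H|[Ha Hb] X [->|->]] //.
by split; apply: H; [left|right].
Qed.

Lemma hsets_setU2 (A B : P) (al be : Pi) :
  h A al -> h A be -> h B al -> h B be -> hsets h [set A; B] [set al; be].
Proof. by move=> ? ? ? ? X pi [->|->] [->|->]. Qed.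

(** By axiom [4] the common points of [al] and [be] form [{A,B}^hh], so a plane through two points
    of an axis contains the whole axis. *)
Lemma axis_incident (A B X : P) (al be pi : Pi) :
  A <> B -> al <> be -> h A al -> h A be -> h B al -> h B be ->
  h X al -> h X be -> h A pi -> h B pi -> h X pi.
Proof.
move=> nA nal Aa Ab Ba Bb Xa Xb Ap Bp.
have [_ e] := ax4 nA nal (hsets_setU2 Aa Ab Ba Bb).
have : hpoints h [set al; be] X by apply/hpoints_setU2.
by rewrite e; apply; apply/hplanes_setU2.
Qed.

Lemma ex_plane_off (O : P) : exists sigma, ~ h O sigma.
Proof.
apply: contrapT => /forallNP H; apply: (ax1.1 O).
by apply/seteqP; split=> // pi _ X ->; apply: contrapT; apply: H.
Qed.

Lemma ex_point3 (al be ga : Pi) : exists X, [/\ h X al, h X be & h X ga].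
Proof.
have /eqP/set0P [X HX] := ax3.2 al be ga.
by exists X; split; apply: HX; [left; left|left; right|right].
Qed.

Lemma ex_two_points (al be : Pi) :
  exists A B, A <> B /\ [/\ h A al, h A be, h B al & h B be].
Proof.
have /card_leP [f] := ax2.2 al be.
have i0 : (0 : nat) \in `I_3 by rewrite inE.
have i1 : (1 : nat) \in `I_3 by rewrite inE.
(* The images of 0 and 1 under the injection given by axiom [2] are the two points. *)
pose x : `I_3 := SigSub i0; pose y : `I_3 := SigSub i1.
have /hpoints_setU2 [? ?] := set_valP (f x).
have /hpoints_setU2 [? ?] := set_valP (f y).
exists (val (f x)), (val (f y)); split=> // /val_inj e.
have : x = y by apply: (@inj _ _ _ f) => //; rewrite inE.
by move=> /(congr1 val).
Qed.

Lemma is_line_meet (al be : Pi) : al <> be -> is_line h (meet_line h al be).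
Proof.
move=> nal; have [A [B [nA [Aa Ab Ba Bb]]]] := ex_two_points al be.
have hs := hsets_setU2 Aa Ab Ba Bb.
have [e1 e2] := ax4 nA nal hs.
by exists A, B, al, be; split; split; rewrite ?pts_meet ?pls_meet.
Qed.

(** This settles the degenerate case in which the first and third diagonal planes coincide. *)
Lemma collinear_planes2 (al be : Pi) : collinear_planes h [set al; be; al].
Proof.
have sub (be' : Pi) : be = al \/ be' = be ->
    [set al; be; al] `<=` pls (meet_line h al be').
  rewrite pls_meet => e pi H X /hpoints_setU2 [Xa Xb].
  by case: H => [[->|->]|->] //; case: e => [->|<-].
have [e|nal] := pselect (be = al).
  have [X [Xal _ _]] := ex_point3 al al al.
  (* A plane missing a point of [al] differs from [al], so the two span a line. *)
  have [s Xs] := ex_plane_off X.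
  exists (meet_line h al s); last by apply: sub; left.
  by apply: is_line_meet => es; apply: Xs; rewrite -es.
exists (meet_line h al be); last by apply: sub; right.
by apply: is_line_meet => e; apply: nal.
Qed.

(** If the axis of [al] and [be] had two points in [sigma], it would lie in [sigma], and [O] with
    it. *)
Lemma trace_point_unique (O X Y : P) (al be sigma : Pi) :
  al <> be -> ~ h O sigma -> h O al -> h O be ->
  h X al -> h X be -> h X sigma -> h Y al -> h Y be -> h Y sigma -> X = Y.
Proof.
move=> nal nO Oa Ob Xa Xb Xs Ya Yb Ys; apply: contrapT => nX; apply: nO.
exact: (axis_incident nX nal).
Qed.

Lemma pts_join_planes (A B : P) (al be : Pi) :
  A <> B -> al <> be -> h A al -> h A be -> h B al -> h B be ->
  pts (join_line h A B) = hpoints h [set al; be].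
Proof.
move=> nA nal Aa Ab Ba Bb; rewrite pts_join.
by have [_ ->] := ax4 nA nal (hsets_setU2 Aa Ab Ba Bb).
Qed.

(** The joins of [A], [B] and of [C], [D] are the traces of [al] and [be] on [sigma], so their
    intersection is the common point of three planes. *)
Lemma is_dot_join (O A B C D X : P) (al be sigma : Pi) :
  ~ h O sigma -> al <> be -> A <> B -> C <> D ->
  h O al -> h A al -> h B al -> h O be -> h C be -> h D be ->
  h A sigma -> h B sigma -> h C sigma -> h D sigma ->
  h X al -> h X be -> h X sigma -> is_dot (join_line h A B) (join_line h C D) X.
Proof.
move=> nO nal nA nC Oa Aa Ba Ob Cb Db As Bs Cs Ds Xa Xb Xs.
have nas : al <> sigma by move=> e; apply: nO; rewrite -e.
have nbs : be <> sigma by move=> e; apply: nO; rewrite -e.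
rewrite /is_dot (pts_join_planes nA nas) // (pts_join_planes nC nbs) //.
apply/seteqP; split=> [Y [/hpoints_setU2 [? ?] /hpoints_setU2 [? ?]]|Y ->] /=.
  exact: (trace_point_unique nal nO).
by split; apply/hpoints_setU2.
Qed.

(** * Lines determined by two of their points or planes *)

Lemma is_line_incident (l : set (P + Pi)) (X : P) (pi : Pi) :
  is_line h l -> pts l X -> pls l pi -> h X pi.
Proof.
move=> [A [B [al [be [_ [_ e2 e3 _]]]]]] lX; rewrite e3; apply.
by rewrite -e2.
Qed.

Lemma is_line_pls (l : set (P + Pi)) (A B : P) :
  is_line h l -> A <> B -> pts l A -> pts l B -> pls l = hplanes h [set A; B].
Proof.
move=> ll nA lA lB; case: ll => [C [D [al [be [[nC nal hs] [_ e2 e3 _]]]]]].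
move: lA lB; rewrite e2 => /hpoints_setU2 [Aa Ab] /hpoints_setU2 [Ba Bb].
by rewrite e3; have [-> _] := ax4 nA nal (hsets_setU2 Aa Ab Ba Bb).
Qed.

Lemma is_line_pts (l : set (P + Pi)) (al be : Pi) :
  is_line h l -> al <> be -> pls l al -> pls l be ->
  pts l = hpoints h [set al; be].
Proof.
move=> ll nal lal lbe.
case: ll => [C [D [al' [be' [[nC nal' hs] [e1 _ _ e4]]]]]].
move: lal lbe; rewrite e4 => /hplanes_setU2 [Ca Da] /hplanes_setU2 [Cb Db].
by rewrite e1; have [_ ->] := ax4 nC nal (hsets_setU2 Ca Cb Da Db).
Qed.

Lemma is_line_eq (l m : set (P + Pi)) (A B : P) :
  is_line h l -> is_line h m -> A <> B ->
  pts l A -> pts l B -> pts m A -> pts m B -> l = m.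
Proof.
move=> ll lm nA lA lB mA mB.
have e : pls l = pls m by rewrite (is_line_pls ll nA) // (is_line_pls lm nA).
have e' : pts l = pts m.
  (* The two planes defining [l] also belong to [m], and they determine the points of both. *)
  case: (ll) => [_ [_ [al [be [[_ nal _] [_ _ e3 _]]]]]].
  have lal : pls l al by rewrite e3 => X /hpoints_setU2 [].
  have lbe : pls l be by rewrite e3 => X /hpoints_setU2 [].
  by rewrite (is_line_pts ll nal) // (is_line_pts lm nal) // -e.
apply/funext => -[X|pi].
- exact: (f_equal (fun s : set P => s X) e').
- exact: (f_equal (fun s : set Pi => s pi) e).
Qed.

(** The planes [omega] and [al] span [m]. If [L] were on [al], both [O] and [L] would be on [m],
    forcing [l = m]. *)
Lemma pencil_center_off (l m : set (P + Pi)) (O L : P) (omega al : Pi) :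
  is_line h l -> is_line h m -> l <> m -> O <> L ->
  pts l O -> pts m O -> pts l L -> pls l omega -> pls m omega -> pls m al ->
  omega <> al -> ~ h L al.
Proof.
move=> ll lm nl nO lO mO lL lom mom mal nom Lal; apply: nl.
apply: (is_line_eq ll lm nO) => //.
rewrite (is_line_pts lm nom) //; apply/hpoints_setU2; split=> //.
exact: (is_line_incident ll).
Qed.

(** The lines of the configuration are represented by their traces [L1], [L2] on [sigma]. The last
    six hypotheses say which axes each of [a0], [b0], [c0] contains. *)
Lemma axiomP_trace (O L1 L2 : P) (sigma a1 b1 c1 a2 b2 c2 a0 b0 c0 : Pi) :
  axiomP h -> ~ h O sigma -> h L1 sigma -> h L2 sigma ->
  List.NoDup [:: a1; b1; c1; a2; b2; c2] ->
  [/\ h O a1, h O b1 & h O c1] -> [/\ h O a2, h O b2 & h O c2] ->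
  [/\ h O a0, h O b0 & h O c0] ->
  [/\ h L1 a1, h L1 b1 & h L1 c1] -> [/\ h L2 a2, h L2 b2 & h L2 c2] ->
  [/\ ~ h L1 a2, ~ h L1 b2 & ~ h L1 c2] ->
  [/\ ~ h L2 a1, ~ h L2 b1 & ~ h L2 c1] ->
  (forall X, h X b1 -> h X c2 -> h X a0) ->
  (forall X, h X b2 -> h X c1 -> h X a0) ->
  (forall X, h X c1 -> h X a2 -> h X b0) ->
  (forall X, h X c2 -> h X a1 -> h X b0) ->
  (forall X, h X a1 -> h X b2 -> h X c0) ->
  (forall X, h X a2 -> h X b1 -> h X c0) ->
  collinear_planes h [set a0; b0; c0].
Proof.
move=> axP nO L1s L2s nd [Oa1 Ob1 Oc1] [Oa2 Ob2 Oc2] [Oa0 Ob0 Oc0].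
move=> [L1a1 L1b1 L1c1] [L2a2 L2b2 L2c2] [L1a2 L1b2 L1c2] [L2a1 L2b1 L2c1].
move=> bc0 cb0 ca0 ac0 ab0 ba0.
have [<-|na0c0] := pselect (a0 = c0); first exact: collinear_planes2.
have [na1b1 na1c1 na1c2] : [/\ a1 <> b1, a1 <> c1 & a1 <> c2].
  by split=> e; move: nd; rewrite e !List.NoDup_cons_iff /=; tauto.
have [nb1c1 nc1a2] : b1 <> c1 /\ c1 <> a2.
  by split=> e; move: nd; rewrite e !List.NoDup_cons_iff /=; tauto.
have [na2b2 na2c2 nb2c2] : [/\ a2 <> b2, a2 <> c2 & b2 <> c2].
  by split=> e; move: nd; rewrite e !List.NoDup_cons_iff /=; tauto.
have nbs1 : b1 <> sigma by move=> e; apply: nO; rewrite -e.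
have nbs2 : b2 <> sigma by move=> e; apply: nO; rewrite -e.
(* In [sigma], two planes of the first pencil share only [L1], which is on no plane of the
   second. *)
have pencil1 Y : h Y sigma -> h Y a2 \/ h Y b2 \/ h Y c2 ->
    [/\ ~ (h Y a1 /\ h Y b1), ~ (h Y b1 /\ h Y c1) & ~ (h Y a1 /\ h Y c1)].
  move=> Ys H; split=> -[Y1 Y2];
    [have e : Y = L1 by apply: (trace_point_unique na1b1 nO)
    |have e : Y = L1 by apply: (trace_point_unique nb1c1 nO)
    |have e : Y = L1 by apply: (trace_point_unique na1c1 nO)];
    by move: H; rewrite e; tauto.
have pencil2 Y : h Y sigma -> h Y a1 \/ h Y b1 \/ h Y c1 ->
    [/\ ~ (h Y a2 /\ h Y b2), ~ (h Y b2 /\ h Y c2) & ~ (h Y a2 /\ h Y c2)].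
  move=> Ys H; split=> -[Y1 Y2];
    [have e : Y = L2 by apply: (trace_point_unique na2b2 nO)
    |have e : Y = L2 by apply: (trace_point_unique nb2c2 nO)
    |have e : Y = L2 by apply: (trace_point_unique na2c2 nO)];
    by move: H; rewrite e; tauto.
(* [O'] takes the role of [O] in axiom [P], with the traces of [b1] and [b2] as the two lines. *)
have [O' [O'b1 O'b2 O's]] := ex_point3 b1 b2 sigma.
have [U1 [U1b1 U1a2 U1s]] := ex_point3 b1 a2 sigma.
have [V1 [V1b1 V1c2 V1s]] := ex_point3 b1 c2 sigma.
have [U2 [U2a1 U2b2 U2s]] := ex_point3 a1 b2 sigma.
have [V2 [V2c1 V2b2 V2s]] := ex_point3 c1 b2 sigma.
have [A0 [A0a1 A0c2 A0s]] := ex_point3 a1 c2 sigma.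
have [B0 [B0c1 B0a2 B0s]] := ex_point3 c1 a2 sigma.
have [X [Xa0 Xc0 Xs]] := ex_point3 a0 c0 sigma.
(* A coincidence would put a point on two planes of one pencil and one of the other, or a centre on
   a plane of the opposite pencil. *)
have ndP : List.NoDup [:: O'; U1; V1; L1; V2; U2; L2].
  have [O'1 O'2 _] := pencil1 O' O's (or_intror (or_introl O'b2)).
  have [O'3 O'4 _] := pencil2 O' O's (or_intror (or_introl O'b1)).
  have [U1a U1b _] := pencil1 U1 U1s (or_introl U1a2).
  have [_ _ U1c] := pencil2 U1 U1s (or_intror (or_introl U1b1)).
  have [V1a V1b _] := pencil1 V1 V1s (or_intror (or_intror V1c2)).
  have [_ _ U2c] := pencil1 U2 U2s (or_intror (or_introl U2b2)).
  rewrite !List.NoDup_cons_iff /=.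
  clear -L1b1 L1a2 L1b2 L1c2 L2a1 L2b1 L2c1 O'b1 O'b2 U1b1 U1a2 V1b1 V1c2 U2a1
    U2b2 V2c1 V2b2 O'1 O'2 O'3 O'4 U1a U1b U1c V1a V1b U2c.
  repeat split; try exact: List.NoDup_nil;
    by move=> H; decompose [or] H; subst; tauto.
have nA0B0 : A0 <> B0.
  have [_ _ n] := pencil1 A0 A0s (or_intror (or_intror A0c2)).
  by move=> e; apply: n; split=> //; rewrite e.
have [nL2U1 nV1L2 nL1V2] : [/\ L2 <> U1, V1 <> L2 & L1 <> V2].
  by split=> e; move: ndP; rewrite e !List.NoDup_cons_iff /=; tauto.
have [nU2L1 nU1U2 nV2V1] : [/\ U2 <> L1, U1 <> U2 & V2 <> V1].
  by split=> e; move: ndP; rewrite e !List.NoDup_cons_iff /=; tauto.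
have ptsP (b : Pi) (Y : P) : h Y b -> h Y sigma -> pts (meet_line h b sigma) Y.
  by move=> ? ?; rewrite pts_meet; apply/hpoints_setU2.
have plsP (b : Pi) : pls (meet_line h b sigma) sigma.
  by rewrite pls_meet => Y /hpoints_setU2 [].
(* The joins [V1 L2], [U2 L1] are the traces of [c2], [a1]; [L1 V2], [L2 U1] those of [c1], [a2];
   [U1 U2], [V2 V1] those of [c0], [a0]. Hence the diagonal points are [A0], [B0], [X]. *)
have [|||||||||||l ll sl] := axP (meet_line h b1 sigma) (meet_line h b2 sigma)
    O' sigma U1 V1 L1 V2 U2 L2 A0 B0 X (is_line_meet nbs1) (is_line_meet nbs2).
- move=> e; apply: L1b2; have := ptsP _ _ L1b1 L1s.
  by rewrite e pts_meet => /hpoints_setU2 [].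
- exact: ptsP.
- exact: ptsP.
- exact: plsP.
- exact: plsP.
- by split; apply: ptsP.
- by split; apply: ptsP.
- exact: ndP.
- by apply: (@is_dot_join O _ _ _ _ _ c2 a1 sigma) => // e; apply: na1c2.
- by apply: (@is_dot_join O _ _ _ _ _ c1 a2 sigma).
- by apply: (@is_dot_join O _ _ _ _ _ c0 a0 sigma); auto.
(* [b0] contains [A0] and [B0], hence their whole line, on which [X] lies. *)
have Xb0 : h X b0.
  case: ll => [_ [_ [al [be [[_ nal _] [_ e2 _ _]]]]]].
  have on Y : [set A0; B0; X] Y -> h Y al /\ h Y be.
    by move=> /sl; rewrite e2 => /hpoints_setU2.
  have [? ?] := on A0 (or_introl (or_introl erefl)).
  have [? ?] := on B0 (or_introl (or_intror erefl)).
  have [? ?] := on X (or_intror erefl).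
  by apply: (axis_incident nA0B0 nal) => //; auto.
(* [O] and [X] are two points of the axis of [a0] and [c0]; both lie on [b0], so [b0] contains that
   axis. *)
have nOX : O <> X by move=> e; apply: nO; rewrite e.
exists (meet_line h a0 c0); first exact: is_line_meet.
rewrite pls_meet => pi Hpi Y /hpoints_setU2 [Ya0 Yc0].
case: Hpi => [[->|->]|->] //.
exact: (axis_incident nOX na0c0).
Qed.

(** * From [P] to [P*] *)

Lemma axiomP_axiomPstar : axiomP h -> axiomPstar h.
Proof.
move=> axP l1 l2 O om a1 b1 c1 a2 b2 c2 a0 b0 c0 ll1 ll2 nl O1 O2 om1 om2.
move=> [la1 lb1 lc1] [la2 lb2 lc2] nd.
rewrite /is_square !pls_meet => sq1 sq2 sq3.
(* A plane of [{al,be}^hh] is one through every common point of [al] and [be]. *)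
have square (al be ga de pi : Pi) :
    hplanes2 h [set al; be] `&` hplanes2 h [set ga; de] = [set pi] ->
    (forall X, h X al -> h X be -> h X pi) /\
    (forall X, h X ga -> h X de -> h X pi).
  move=> e; have [H1 H2] : (hplanes2 h [set al; be] `&`
    hplanes2 h [set ga; de]) pi by rewrite e.
  by split=> X ? ?; [apply: H1|apply: H2]; apply/hpoints_setU2.
have [bc0 cb0] := square _ _ _ _ _ sq1.
have [ca0 ac0] := square _ _ _ _ _ sq2.
have [ab0 ba0] := square _ _ _ _ _ sq3.
have [na1 nb1 nc1] : [/\ om <> a1, om <> b1 & om <> c1].
  by split=> e; move: nd; rewrite e !List.NoDup_cons_iff /=; tauto.
have [na2 nb2 nc2] : [/\ om <> a2, om <> b2 & om <> c2].
  by split=> e; move: nd; rewrite e !List.NoDup_cons_iff /=; tauto.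
have [sigma nO] := ex_plane_off O.
(* By axiom [3], [om], [pi] and [sigma] share a point; it is on [l] because [om] and [pi] span
   [l]. *)
have trace l pi : is_line h l -> pls l om -> pls l pi -> om <> pi ->
    exists L, [/\ pts l L, h L sigma & O <> L].
  move=> ll lom lpi npi; have [L [Lom Lpi Ls]] := ex_point3 om pi sigma.
  exists L; split=> //; last by move=> e; apply: nO; rewrite e.
  by rewrite (is_line_pts ll npi) //; apply/hpoints_setU2.
have [L1 [lL1 L1s nL1]] := trace l1 a1 ll1 om1 la1 na1.
have [L2 [lL2 L2s nL2]] := trace l2 a2 ll2 om2 la2 na2.
have inc1 := fun X pi => @is_line_incident l1 X pi ll1.
have inc2 := fun X pi => @is_line_incident l2 X pi ll2.
have nl' : l2 <> l1 by move=> e; apply: nl.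
have nd' : List.NoDup [:: a1; b1; c1; a2; b2; c2].
  by move: nd; rewrite List.NoDup_cons_iff => -[].
apply: (@axiomP_trace O L1 L2 sigma a1 b1 c1 a2 b2 c2) => //; split.
all: by [apply: inc1 | apply: inc2 | auto
       | apply: (pencil_center_off ll1 ll2 nl nL1 O1 O2 lL1 om1 om2)
       | apply: (pencil_center_off ll2 ll1 nl' nL2 O2 O1 lL2 om2 om1)].
Qed.

End Geometry.

Theorem theorem2 (P Pi : Type) (h : P -> Pi -> Prop)
    (P_neq0 : [set: P] !=set0) (Pi_neq0 : [set: Pi] !=set0)
    (ax1 : axiom1 h) (ax2 : axiom2 h) (ax3 : axiom3 h) (ax4 : axiom4 h) :
  axiomP h <-> axiomPstar h.
Proof.
split; first exact: axiomP_axiomPstar.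
(* The dual of the dual is [h], so one lemma translates both the hypothesis and the goal. *)
move=> /axiomP_dual axP; apply: (@axiomP_dual _ _ (fun pi X => h X pi)).
apply: axiomP_axiomPstar axP.
- exact: axiom1_dual.
- exact: axiom2_dual.
- exact: axiom3_dual.
- exact: axiom4_dual.
Qed.
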